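(* Let $t_0\geq 1$ be a fixed, sufficiently large constant. For real $r,t,y$ with $\frac12\leq r\leq \frac32$, $|t| \geq t_0$ and $0<y <1$, we have $$K_{r - \frac12 +i t}(y) = O\left( y^{\frac12-r}\, e^{-|t|\pi/2}\, |t|^{r-1}\right),$$ where the implied constant depends only on $t_0$ and is uniformly bounded for all large enough $t_0$.
   Context: $K_\nu$ denotes the $K$-Bessel function (modified Bessel function of the second kind), for $y>0$ and $\nu\in\mathbb{C}$ given by $K_\nu(y)=\frac12\int_{-\infty}^{\infty} e^{-y\cosh R+\nu R}\,dR$. *)

(* Defs.v *)
From Stdlib Require Import Reals.
From Coquelicot Require Import Coquelicot.

Open Scope R_scope.

Definition Cexp (z : C) : C :=
  (exp (Re z) * cos (Im z), exp (Re z) * sin (Im z)).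

(* The integrand is complex-valued, over a real variable: [C] is taken with its
   structure of complete normed space over the reals, and [RInt_gen] is the
   improper Riemann integral, both endpoints tending to infinity
   independently.  It converges for every [nu] as soon as [0 < y]. *)
Definition BesselK (nu : C) (y : R) : C :=
  Cmult (RtoC (1 / 2))
    (RInt_gen (V := C_R_CompleteNormedModule)
       (fun u : R =>
          Cexp (Cplus (RtoC (- (y * cosh u))) (Cmult nu (RtoC u))))
       (Rbar_locally m_infty) (Rbar_locally p_infty)).

(* Main.v *)
Require Import Defs.
From Stdlib Require Import Reals Lra Psatz.
From Coquelicot Require Import Coquelicot.

(** The bound is proved by the saddle point method.  Write nu = s + i t with
    s = r - 1/2.  By the symmetries of the integral one may take t > 0.  The
    exponent - y cosh z + nu z of the entire integrand has, for large t / y, its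
    relevant saddle points near i PI / 2 + u0 and i PI / 2 - u0, where
    u0 = ln (2 t / y).  There the integrand has modulus about
    e^(- t PI / 2) (2 t / y)^(+- s), and the exponent has second derivative of
    size t, so that each saddle point should contribute its modulus times
    t^(-1/2).  This is the bound claimed.

    To make this uniform down to y = 0 and s = 0, the real line is deformed into
    the graph of PI / 2 + max (u0 - |x|, -1).  This graph crosses both saddle
    points with slope 1 in absolute value, rises to height PI / 2 + u0 above the
    origin, and is horizontal outside [- u0 - 1, u0 + 1].  Along it the modulus
    of the integrand, relative to its size at the saddle point, is at most a
    constant times the Lorentzian 1 / (1 + t (|x| - u0)^2 / 64)
    ([modulus_slant], [modulus_tail]).  The Lorentzian has integral
    O(t^(-1/2)) however long the slanted parts are; estimating the modulus on a
    segment of height PI / 2 between the saddle points would instead, for s = 0,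
    lose a factor growing like ln (1 / y).

    The deformation rests on Cauchy's theorem, obtained by differentiating along
    the graph an explicit primitive of the closed differential form
    ([is_derive_path_integral]).  Since the majorant also has an explicit
    primitive, an arctangent, a comparison of derivatives ([increment_le])
    gives both the convergence of the improper integral and its bound. *)

Open Scope R_scope.

(** * The integrand on the complex plane *)

(** With nu = s + i t and z = x + i w, the number exp (- y cosh z + nu z) has
    modulus the exponential below and argument the angle below, up to the
    constant phase [c].  Carrying [c] makes one family serve for the real part,
    for the imaginary part, and for the sign changes of s and t. *)
Definition integrand_re (s t y c x w : R) : R :=
  exp (- (y * cosh x * cos w) + s * x - t * w)
  * cos (t * x + s * w - y * sinh x * sin w + c).
Definition integrand_im (s t y c x w : R) : R :=
  exp (- (y * cosh x * cos w) + s * x - t * w)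
  * sin (t * x + s * w - y * sinh x * sin w + c).

(** One function records both Cauchy-Riemann equations used here: it is the
    x-derivative of the imaginary part and minus the w-derivative of the real
    part. *)
Definition integrand_im_dx (s t y c x w : R) : R :=
  (s - y * sinh x * cos w) * integrand_im s t y c x w
  + (t - y * cosh x * sin w) * integrand_re s t y c x w.

Lemma is_derive_integrand_im_x s t y c x w :
  is_derive (fun z => integrand_im s t y c z w) x (integrand_im_dx s t y c x w).
Proof.
unfold integrand_im_dx, integrand_re, integrand_im, cosh, sinh.
auto_derive; [easy | unfold Rminus, Rdiv; field].
Qed.

Lemma is_derive_integrand_re_w s t y c x w :
  is_derive (fun z => integrand_re s t y c x z) w (- integrand_im_dx s t y c x w).
Proof.
unfold integrand_im_dx, integrand_re, integrand_im, cosh, sinh.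
auto_derive; [easy | unfold Rminus, Rdiv; field].
Qed.

(* Peels a continuity goal in two variables down to the variables themselves;
   the composition case comes last because its pattern matches everything. *)
Ltac continuity_2d_tac :=
  match goal with
  | |- continuity_2d_pt (fun u v => _ + _) _ _ => apply continuity_2d_pt_plus
  | |- continuity_2d_pt (fun u v => _ - _) _ _ => apply continuity_2d_pt_minus
  | |- continuity_2d_pt (fun u v => - _) _ _ => apply continuity_2d_pt_opp
  | |- continuity_2d_pt (fun u v => _ * _) _ _ => apply continuity_2d_pt_mult
  | |- continuity_2d_pt (fun u v => u) _ _ => apply continuity_2d_pt_id1
  | |- continuity_2d_pt (fun u v => v) _ _ => apply continuity_2d_pt_id2
  | |- continuity_2d_pt (fun u v => ?c) _ _ => apply continuity_2d_pt_const
  | |- continuity_2d_pt (fun u v => ?f (@?g u v)) _ _ =>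
      apply (continuity_1d_2d_pt_comp f g);
      [apply derivable_continuous_pt; auto with real; reg|]
  end.

Lemma continuity_2d_integrand_re s t y c x w : continuity_2d_pt (integrand_re s t y c) x w.
Proof. unfold integrand_re; repeat continuity_2d_tac. Qed.

Lemma continuity_2d_integrand_im s t y c x w : continuity_2d_pt (integrand_im s t y c) x w.
Proof. unfold integrand_im; repeat continuity_2d_tac. Qed.

Lemma continuity_2d_integrand_im_dx s t y c x w :
  continuity_2d_pt (integrand_im_dx s t y c) x w.
Proof.
unfold integrand_im_dx; repeat continuity_2d_tac;
  [apply continuity_2d_integrand_im | apply continuity_2d_integrand_re].
Qed.

Lemma continuous_of_2d_l (f : R -> R -> R) x w :
  continuity_2d_pt f x w -> continuous (fun z => f z w) x.
Proof.
intros Hf; apply continuity_2d_pt_filterlim in Hf.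
apply (continuous_comp_2 (fun z => z) (fun _ => w) f).
- apply continuous_id.
- apply continuous_const.
- exact Hf.
Qed.

Lemma continuous_of_2d_r (f : R -> R -> R) x w :
  continuity_2d_pt f x w -> continuous (fun z => f x z) w.
Proof.
intros Hf; apply continuity_2d_pt_filterlim in Hf.
apply (continuous_comp_2 (fun _ => x) (fun z => z) f).
- apply continuous_const.
- apply continuous_id.
- exact Hf.
Qed.

(** * Deforming the contour *)

(** Cauchy's theorem in differential form.  The form A dx - B dw is closed, and
    integrating it along the real axis up to x, then vertically up to
    theta(x), gives a primitive evaluated on the graph of theta.  Its
    derivative along the graph is therefore the form itself: differentiating
    the vertical integral under the sign produces A(x,0) - A(x,theta(x)), which
    trades the value of A on the axis for its value on the graph. *)
Lemma is_derive_path_integral (A B D : R -> R -> R) (theta : R -> R) x dtheta :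
  (forall x w, continuity_2d_pt A x w) ->
  (forall x w, continuity_2d_pt B x w) ->
  (forall x w, continuity_2d_pt D x w) ->
  (forall x w, is_derive (fun z => B z w) x (D x w)) ->
  (forall x w, is_derive (fun z => A x z) w (- D x w)) ->
  is_derive theta x dtheta ->
  is_derive
    (fun z => RInt (fun u => A u 0) 0 z - RInt (fun w => B z w) 0 (theta z)) x
    (A x (theta x) - B x (theta x) * dtheta).
Proof.
intros cA cB cD dB dA dth.
assert (iB : forall z a b, ex_RInt (fun w => B z w) a b).
{ intros z a b; apply (ex_RInt_continuous (V := R_CompleteNormedModule)).
  intros w _; now apply continuous_of_2d_r. }
assert (cDB : forall u v, continuity_2d_pt (fun u v => Derive (fun z => B z v) u) u v).
{ intros u v; apply (continuity_2d_pt_ext D); auto.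
  intros; symmetry; now apply is_derive_unique. }
assert (E : RInt (fun w => Derive (fun z => B z w) x) 0 (theta x)
            = A x 0 - A x (theta x)).
{ rewrite (RInt_ext _ (fun w => D x w)) by
    (intros; now apply is_derive_unique).
  apply is_RInt_unique.
  replace (A x 0 - A x (theta x)) with
    (minus (- A x (theta x)) (- A x 0)) by (unfold minus, plus, opp; simpl; ring).
  apply (is_RInt_derive (fun w => - A x w)).
  - intros w _; rewrite <- (Ropp_involutive (D x w)).
    apply (is_derive_opp (fun w => A x w)), dA.
  - intros w _; now apply continuous_of_2d_r. }
replace (A x (theta x) - B x (theta x) * dtheta) with
  (minus (A x 0) ((A x 0 - A x (theta x)) + B x (theta x) * dtheta))
  by (unfold minus, plus, opp; simpl; ring).
rewrite <- E.
apply (is_derive_minus (V := R_NormedModule)).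
- apply (is_derive_RInt (fun u => A u 0) _ 0).
  + apply filter_forall; intros z.
    apply (RInt_correct (V := R_CompleteNormedModule)).
    apply (ex_RInt_continuous (V := R_CompleteNormedModule)).
    intros u _; now apply (continuous_of_2d_l A).
  + now apply (continuous_of_2d_l A).
- apply is_derive_RInt_param_bound_comp_aux3.
  + apply filter_forall; auto.
  + exists (mkposreal 1 Rlt_0_1); apply filter_forall; auto.
  + assumption.
  + exists (mkposreal 1 Rlt_0_1); apply filter_forall.
    intros z v _; eexists; apply dB.
  + auto.
  + exists (mkposreal 1 Rlt_0_1); auto.
  + apply continuity_pt_filterlim.
    now apply (continuous_of_2d_r B).
Qed.

(** Comparison of primitives, by the mean value theorem for h + W and h - W.
    It replaces the integral of the majorant of |W'| by an explicit primitive
    of it. *)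
Lemma increment_le (W h W' h' : R -> R) a b :
  a <= b ->
  (forall x, a <= x <= b -> is_derive W x (W' x)) ->
  (forall x, a <= x <= b -> is_derive h x (h' x)) ->
  (forall x, a <= x <= b -> Rabs (W' x) <= h' x) ->
  Rabs (W b - W a) <= h b - h a.
Proof.
intros ab dW dh le.
assert (mono : forall (g g' : R -> R),
  (forall x, a <= x <= b -> is_derive g x (g' x)) ->
  (forall x, a <= x <= b -> 0 <= g' x) -> g a <= g b).
{ intros g g' dg pos.
  destruct (MVT_gen g a b g') as [z [zab E]];
    rewrite ?Rmin_left, ?Rmax_right in * by lra.
  - intros; apply dg; lra.
  - intros x xab; apply continuity_pt_filterlim.
    apply (ex_derive_continuous (V := R_NormedModule)).
    eexists; apply dg; lra.
  - assert (0 <= g' z * (b - a)) by (apply Rmult_le_pos; [apply pos|]; lra).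
    lra. }
apply Rabs_le; split.
- enough (h a + W a <= h b + W b) by lra.
  apply (mono (fun x => h x + W x) (fun x => h' x + W' x)).
  + intros; apply (is_derive_plus h W); auto.
  + intros x xab; specialize (le x xab); apply Rabs_le_between in le; lra.
- enough (h a - W a <= h b - W b) by lra.
  apply (mono (fun x => h x - W x) (fun x => h' x - W' x)).
  + intros; apply (is_derive_minus h W); auto.
  + intros x xab; specialize (le x xab); apply Rabs_le_between in le; lra.
Qed.

(** The Cauchy criterion, transferred from h, which is nondecreasing and
    bounded and so is within eps of its supremum from some point on. *)
Lemma filterlim_of_increment_le (W h : R -> R) X M :
  (forall a b, X <= a <= b -> Rabs (W b - W a) <= h b - h a) ->
  (forall x, h x <= M) ->
  exists L : R, filterlim W (Rbar_locally p_infty) (locally L).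
Proof.
intros inc hM.
destruct (completeness (fun v => exists x, X <= x /\ v = h x)) as [S [ub lub]].
{ exists M; intros v [x [_ ->]]; auto. }
{ exists (h X), X; split; [lra | easy]. }
apply (filterlim_locally_cauchy (U := R_CompleteSpace)).
intros eps.
assert (exists x0, X <= x0 /\ S - eps < h x0) as [x0 [Xx0 Hx0]].
{ apply Classical_Prop.NNPP; intros no.
  assert (S <= S - eps) as abs.
  { apply lub; intros v [x [Xx ->]]; apply Rnot_lt_le; intros lt.
    apply no; now exists x. }
  assert (H := cond_pos eps); lra. }
exists (fun x => x0 < x); split; [now exists x0|].
assert (sym : forall u v, x0 < u -> u <= v -> Rabs (W v - W u) < eps).
{ intros u v x0u uv.
  assert (h v <= S) by (apply ub; exists v; split; [lra | easy]).
  assert (H1 := inc u v (conj (Rle_trans _ _ _ Xx0 (Rlt_le _ _ x0u)) uv)).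
  assert (H2 := inc x0 u (conj Xx0 (Rlt_le _ _ x0u))).
  assert (H3 := Rabs_pos (W u - W x0)).
  lra. }
intros u v Hu Hv; change (Rabs (W v - W u) < eps).
destruct (Rle_dec u v) as [uv | uv]; [auto|].
rewrite Rabs_minus_sym; apply sym; lra.
Qed.

(** * The modulus on the deformed contour *)

Lemma exp_le a b : a <= b -> exp a <= exp b.
Proof. intros [lt | ->]; [left; now apply exp_increasing | lra]. Qed.

Lemma exp_lower_quadratic v : 0 <= v -> (1 + v / 2) * (1 + v / 2) <= exp v.
Proof.
intros Hv; replace v with (v / 2 + v / 2) at 3 by field; rewrite exp_plus.
assert (H := exp_ineq1_le (v / 2)); apply Rmult_le_compat; lra.
Qed.

Lemma sin_lower_cubic w : 0 <= w <= 1 -> w - w ^ 3 / 6 <= sin w.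
Proof.
intros Hw; destruct (pre_sin_bound w 0) as [H _]; try lra.
unfold sin_approx, sin_term in H; simpl in H; lra.
Qed.

(** At the point x = u0 - d of the slanted contour, t * gap d is, up to
    bounded terms, the amount by which the exponent of the modulus lies below
    its value at the saddle point d = 0. *)
Definition gap (d : R) : R := d - exp (- d) * sin d.

(** The gap is quadratic near the saddle point and linear far from it; the
    latter is what makes the bound insensitive to the length u0 of the slanted
    part, which is unbounded as y tends to 0. *)
Lemma gap_lower d : -1 <= d -> d ^ 2 / (2 * (1 + Rabs d)) <= gap d.
Proof.
intros Hd; unfold gap.
assert (He := exp_ineq1_le (Rabs d)).
assert (Hp := Rabs_pos d).
assert (0 < / (2 * (1 + Rabs d))) by (apply Rinv_0_lt_compat; lra).
destruct (Rle_dec 0 d) as [H0 | H0].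
- rewrite (Rabs_pos_eq d) in * by lra.
  assert (Hs : sin d <= d).
  { destruct (Req_dec d 0) as [-> | ne]; [rewrite sin_0; lra|].
    apply Rlt_le, sin_lt_x; lra. }
  assert (Hi : exp (- d) <= / (1 + d)).
  { rewrite exp_Ropp; apply Rinv_le_contravar; lra. }
  assert (He0 := exp_pos (- d)).
  assert (exp (- d) * sin d <= / (1 + d) * d).
  { apply Rle_trans with (exp (- d) * d).
    - apply Rmult_le_compat_l; lra.
    - apply Rmult_le_compat_r; lra. }
  replace (d ^ 2 / (2 * (1 + d))) with ((d - / (1 + d) * d) / 2) by (field; lra).
  assert (0 <= d - / (1 + d) * d); [|lra].
  replace (d - / (1 + d) * d) with (d * d * / (1 + d)) by (field; lra).
  apply Rmult_le_pos; [nra | apply Rlt_le, Rinv_0_lt_compat; lra].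
- rewrite Rabs_left in * by lra.
  set (w := - d) in *; replace d with (- w) by (unfold w; ring).
  rewrite sin_neg.
  assert (Hw : 0 <= w <= 1) by (unfold w; lra).
  assert (Hs := sin_lower_cubic w Hw).
  apply Rle_trans with (w ^ 2 / 2).
  + replace ((- w) ^ 2 / (2 * (1 + w))) with (w ^ 2 / 2 * / (1 + w)) by (field; lra).
    rewrite <- (Rmult_1_r (w ^ 2 / 2)) at 2.
    apply Rmult_le_compat_l; [nra|].
    rewrite <- Rinv_1 at 2; apply Rinv_le_contravar; lra.
  + assert ((1 + w) * (w - w ^ 3 / 6) <= exp w * sin w).
    { apply Rmult_le_compat; try lra.
      assert (w ^ 3 <= w) by (simpl; nra); lra. }
    assert (w ^ 3 <= w ^ 2) by (simpl; nra).
    assert (w ^ 4 <= w ^ 2) by (simpl; nra).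
    nra.
Qed.

(** A decay which is Gaussian near the saddle point and exponential far from it
    is dominated by a single Lorentzian of width 8 / sqrt t, whose primitive is
    an arctangent.  Squaring 1 + v/2 is needed to get quadratic decay from the
    region where v is only linear in d. *)
Lemma exp_le_lorentzian t d v :
  1 <= t -> t * (d ^ 2 / (2 * (1 + Rabs d))) <= v ->
  exp (- v) <= / (1 + t * d ^ 2 / 64).
Proof.
intros Ht Hv.
set (X := t * (d ^ 2 / (2 * (1 + Rabs d)))) in *.
assert (Hp := Rabs_pos d).
assert (Hd2 : d ^ 2 = Rabs d ^ 2) by (now rewrite pow2_abs).
assert (0 <= t * d ^ 2) by (rewrite Hd2; apply Rmult_le_pos; simpl; nra).
assert (0 <= X).
{ unfold X, Rdiv; rewrite <- Rmult_assoc; apply Rmult_le_pos; [easy|].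
  apply Rlt_le, Rinv_0_lt_compat; lra. }
rewrite exp_Ropp; apply Rinv_le_contravar; [lra|].
apply Rle_trans with (exp X).
2: now apply exp_le.
apply Rle_trans with (2 := exp_lower_quadratic X ltac:(easy)).
assert (EX : X * (2 * (1 + Rabs d)) = t * d ^ 2) by (unfold X; field; lra).
rewrite Hd2 in *; set (a := Rabs d) in *.
destruct (Rle_dec a 1) as [Ha | Ha].
- assert (t * a ^ 2 <= X * 4) by nra. nra.
- assert (t * a <= X * 4).
  { apply Rmult_le_reg_r with a; [lra|].
    replace (t * a * a) with (X * (2 * (1 + a))) by (rewrite EX; ring). nra. }
  assert (t * a ^ 2 <= (t * a) * (t * a)).
  { replace (t * a * (t * a)) with (t * a ^ 2 * t) by ring. nra. }
  assert (0 <= t * a) by (apply Rmult_le_pos; lra).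
  assert ((t * a) * (t * a) <= (X * 4) * (X * 4)) by (apply Rmult_le_compat; lra).
  nra.
Qed.

(** Up to a negligible error, the saddle points of the exponent, where
    y sinh z = nu with nu close to i t, have real parts plus and minus this
    number, and imaginary part PI / 2.  This value, rather than the exact
    arcosh (t / y), makes y e^x / 2 equal to t e^(x - u0). *)
Definition saddle (t y : R) : R := ln (2 * t / y).

Lemma saddle_pos t y : 4 <= t -> 0 < y < 1 -> 0 < saddle t y.
Proof.
intros Ht Hy; unfold saddle; rewrite <- ln_1; apply ln_increasing; [lra|].
apply Rmult_lt_reg_r with y; [lra|].
replace (2 * t / y * y) with (2 * t) by (field; lra); lra.
Qed.

Lemma cosh_near_saddle t y x :
  4 <= t -> 0 < y < 1 ->
  y * cosh x = t * exp (x - saddle t y) + y / 2 * exp (- x).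
Proof.
intros Ht Hy; unfold cosh, saddle, Rminus; rewrite exp_plus, !exp_Ropp, exp_ln.
- assert (He := exp_pos x); field; repeat split; lra.
- apply Rdiv_lt_0_compat; lra.
Qed.

(** The size of the integrand at the dominating saddle point. *)
Definition envelope (s t y : R) : R :=
  exp (- (t * PI / 2)) * exp (Rabs s * saddle t y).

(** On the line of slope -1 through the saddle point.  The factor exp (3 / 2)
    absorbs two bounded errors in the exponent: 1/2 from the e^(-x) half of
    cosh, and 1 from s x when x exceeds the saddle by at most 1. *)
Lemma modulus_slant s t y x :
  4 <= t -> 0 < y < 1 -> Rabs s <= 1 -> 0 <= x <= saddle t y + 1 ->
  exp (- (y * cosh x * cos (PI / 2 + saddle t y - x)) + s * x
       - t * (PI / 2 + saddle t y - x))
  <= exp (3 / 2) * envelope s t y * / (1 + t * (x - saddle t y) ^ 2 / 64).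
Proof.
intros Ht Hy Hs Hx.
rewrite (cosh_near_saddle t y x Ht Hy).
set (d := saddle t y - x).
replace (x - saddle t y) with (- d) by (unfold d; ring).
replace (PI / 2 + saddle t y - x) with (PI / 2 + d) by (unfold d; ring).
replace (cos (PI / 2 + d)) with (- sin d) by (rewrite cos_plus, cos_PI2, sin_PI2; ring).
assert (Hd : -1 <= d) by (unfold d; lra).
assert (Hl := exp_le_lorentzian t d (t * gap d) ltac:(lra)
  ltac:(apply Rmult_le_compat_l; [lra | now apply gap_lower])).
replace ((- d) ^ 2) with (d ^ 2) by ring.
unfold envelope.
apply Rle_trans with
  (exp (3 / 2) * (exp (- (t * PI / 2)) * exp (Rabs s * saddle t y)) * exp (- (t * gap d))).
2: { apply Rmult_le_compat_l; [|easy].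
     repeat apply Rmult_le_pos; left; apply exp_pos. }
rewrite <- !exp_plus.
apply exp_le.
unfold gap.
assert (Hsx : s * x <= Rabs s * saddle t y + 1).
{ apply Rle_trans with (Rabs s * x).
  - apply Rmult_le_compat_r; [lra | apply Rle_abs].
  - assert (Hp := Rabs_pos s); nra. }
assert (Hs1 : y / 2 * exp (- x) * sin d <= 1 / 2).
{ assert (exp (- x) <= 1) by
    (rewrite <- exp_0; apply exp_le; lra).
  assert (He := exp_pos (- x)).
  destruct (SIN_bound d).
  apply Rle_trans with (y / 2 * exp (- x) * 1); [|nra].
  apply Rmult_le_compat_l; [nra | lra]. }
nra.
Qed.

Lemma sin_1_lower : 5 / 6 <= sin 1.
Proof. assert (H := sin_lower_cubic 1 ltac:(lra)); lra. Qed.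

(** Beyond the slanted part the contour is kept at height PI / 2 - 1, where
    cos w = sin 1 > 0: the modulus decays doubly exponentially.  The bound
    t >= 4 enters through d <= t d / 4, which pays for the growth of
    e^(s x). *)
Lemma modulus_tail s t y x :
  4 <= t -> 0 < y < 1 -> Rabs s <= 1 -> saddle t y + 1 <= x ->
  exp (- (y * cosh x * cos (PI / 2 - 1)) + s * x - t * (PI / 2 - 1))
  <= exp (3 / 2) * envelope s t y * / (1 + t * (x - saddle t y) ^ 2 / 64).
Proof.
intros Ht Hy Hs Hx.
rewrite (cosh_near_saddle t y x Ht Hy), cos_shift.
set (d := x - saddle t y); assert (Hd : 1 <= d) by (unfold d; lra).
assert (Hsin := sin_1_lower).
assert (He : 9 / 4 * d <= exp d).
{ replace d with (1 + (d - 1)) at 2 by ring; rewrite exp_plus.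
  assert (H1 := exp_lower_quadratic 1 ltac:(lra)).
  assert (H2 := exp_ineq1_le (d - 1)).
  apply Rmult_le_compat; lra. }
(* 5/8 is 15/8, from e^d sin 1, minus 1, from the height PI / 2 - 1 being lower
   than PI / 2, minus 1/4, from the growth of e^(s x); each multiplies t d. *)
assert (Hv : t * (d ^ 2 / (2 * (1 + Rabs d))) <= 5 / 8 * t * d).
{ rewrite (Rabs_pos_eq d) by lra.
  replace (5 / 8 * t * d) with (t * (5 / 8 * d)) by ring.
  apply Rmult_le_compat_l; [lra|].
  apply Rmult_le_reg_r with (2 * (1 + d)); [lra|].
  replace (d ^ 2 / (2 * (1 + d)) * (2 * (1 + d))) with (d ^ 2) by (field; lra).
  nra. }
assert (Hl := exp_le_lorentzian t d _ ltac:(lra) Hv).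
unfold envelope.
apply Rle_trans with
  (exp (3 / 2) * (exp (- (t * PI / 2)) * exp (Rabs s * saddle t y))
   * exp (- (5 / 8 * t * d))).
2: { apply Rmult_le_compat_l; [|easy].
     repeat apply Rmult_le_pos; left; apply exp_pos. }
rewrite <- !exp_plus.
apply exp_le.
assert (Hsx : s * x <= Rabs s * saddle t y + d).
{ replace x with (saddle t y + d) by (unfold d; ring).
  assert (H0 := saddle_pos t y Ht Hy).
  apply Rle_trans with (Rabs s * (saddle t y + d)).
  - apply Rmult_le_compat_r; [lra | apply Rle_abs].
  - assert (Hp := Rabs_pos s); nra. }
assert (0 <= y / 2 * exp (- x) * sin 1).
{ repeat apply Rmult_le_pos; try lra; left; apply exp_pos. }
assert (t * (15 / 8 * d) <= t * exp d * sin 1).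
{ rewrite Rmult_assoc; apply Rmult_le_compat_l; [lra|].
  replace (15 / 8 * d) with (9 / 4 * d * (5 / 6)) by field.
  apply Rmult_le_compat; lra. }
nra.
Qed.

(** * The integral over a half line *)

(** The primitive of twice the Lorentzian majorant of the modulus. *)
Definition lorentz_primitive (s t y x : R) : R :=
  2 * (exp (3 / 2) * envelope s t y) * (8 / sqrt t)
  * atan (sqrt t / 8 * (x - saddle t y)).

(** The total variation of [lorentz_primitive]. *)
Definition half_bound (s t y : R) : R :=
  16 * PI * exp (3 / 2) * (envelope s t y / sqrt t).

Lemma is_derive_lorentz_primitive s t y x :
  0 < t ->
  is_derive (lorentz_primitive s t y) x
    (2 * (exp (3 / 2) * envelope s t y * / (1 + t * (x - saddle t y) ^ 2 / 64))).
Proof.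
intros Ht; assert (Hq := sqrt_lt_R0 t Ht).
assert (Ht2 : t = sqrt t * sqrt t) by (now rewrite sqrt_sqrt; lra).
rewrite Ht2 at 3.
assert (0 <= (sqrt t / 8 * (x - saddle t y)) ^ 2) by apply pow2_ge_0.
unfold lorentz_primitive; auto_derive; [easy|].
unfold Rsqr; field; split; [nra | lra].
Qed.

Lemma lorentz_primitive_range s t y a b :
  0 < t ->
  lorentz_primitive s t y a - lorentz_primitive s t y b <= half_bound s t y.
Proof.
intros Ht; assert (Hq := sqrt_lt_R0 t Ht).
unfold lorentz_primitive, half_bound.
set (p := atan _); set (q := atan (_ * (b - _))).
assert (Hpq : p - q <= PI).
{ destruct (atan_bound (sqrt t / 8 * (a - saddle t y))) as [_ Hp].
  destruct (atan_bound (sqrt t / 8 * (b - saddle t y))) as [Hb _].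
  fold p in Hp; fold q in Hb; lra. }
set (E := 2 * (exp (3 / 2) * envelope s t y) * (8 / sqrt t)).
replace (16 * PI * exp (3 / 2) * (envelope s t y / sqrt t)) with (E * PI)
  by (unfold E; field; lra).
rewrite <- Rmult_minus_distr_l; apply Rmult_le_compat_l; [|lra].
unfold E, envelope.
assert (0 < / sqrt t) by (now apply Rinv_0_lt_compat).
repeat apply Rmult_le_pos; try lra; left; apply exp_pos.
Qed.

Lemma Rabs_mult_bounded_le a p b : 0 <= a -> -1 <= p <= 1 -> a <= b -> Rabs (a * p) <= b.
Proof.
intros Ha Hp Hab; apply Rle_trans with (2 := Hab).
rewrite Rabs_mult, (Rabs_pos_eq a) by easy; rewrite <- (Rmult_1_r a) at 2.
now apply Rmult_le_compat_l, Rabs_le.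
Qed.

(** The factor 2 is the length element of a contour of slope at most 1,
    estimated by 1 + |dw|. *)
Lemma modulus_form_le s t y c x w dw m :
  exp (- (y * cosh x * cos w) + s * x - t * w) <= m -> Rabs dw <= 1 ->
  Rabs (integrand_re s t y c x w - integrand_im s t y c x w * dw) <= 2 * m.
Proof.
intros Hm Hdw; unfold integrand_re, integrand_im.
set (r := exp _) in *; set (phi := _ + c).
assert (Hr : 0 <= r) by (left; apply exp_pos).
assert (Hc := Rabs_mult_bounded_le r (cos phi) m Hr (COS_bound phi) Hm).
assert (Hs := Rabs_mult_bounded_le r (sin phi) m Hr (SIN_bound phi) Hm).
unfold Rminus; apply Rle_trans with (1 := Rabs_triang _ _).
rewrite Rabs_Ropp, (Rabs_mult (r * sin phi)).
assert (H1 := Rabs_pos (r * sin phi)); assert (H2 := Rabs_pos dw); nra.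
Qed.

(** The integral from 0 to x + i theta(x) of the closed differential form,
    taken along the real axis and then vertically. *)
Definition path_integral (s t y c : R) (theta : R -> R) (x : R) : R :=
  RInt (fun u => integrand_re s t y c u 0) 0 x
  - RInt (fun w => integrand_im s t y c x w) 0 (theta x).

Lemma path_increment_le s t y c (theta : R -> R) dtheta a b :
  0 < t -> a <= b -> Rabs dtheta <= 1 ->
  (forall x, is_derive theta x dtheta) ->
  (forall x, a <= x <= b ->
     exp (- (y * cosh x * cos (theta x)) + s * x - t * theta x)
     <= exp (3 / 2) * envelope s t y * / (1 + t * (x - saddle t y) ^ 2 / 64)) ->
  Rabs (path_integral s t y c theta b - path_integral s t y c theta a)
  <= lorentz_primitive s t y b - lorentz_primitive s t y a.
Proof.
intros Ht ab Hd dth Hm.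
apply (increment_le (path_integral s t y c theta) (lorentz_primitive s t y)
  (fun x => integrand_re s t y c x (theta x) - integrand_im s t y c x (theta x) * dtheta)
  (fun x => 2 * (exp (3 / 2) * envelope s t y * / (1 + t * (x - saddle t y) ^ 2 / 64)))).
- easy.
- intros x _; apply (is_derive_path_integral _ _ (integrand_im_dx s t y c)); auto.
  + apply continuity_2d_integrand_re.
  + apply continuity_2d_integrand_im.
  + apply continuity_2d_integrand_im_dx.
  + apply is_derive_integrand_im_x.
  + apply is_derive_integrand_re_w.
- intros x _; now apply is_derive_lorentz_primitive.
- intros x Hx; apply modulus_form_le; auto.
Qed.

Lemma filterlim_inv_bound (f : R -> R) C X :
  (forall x, X < x -> Rabs (f x) <= C / x) ->
  filterlim f (Rbar_locally p_infty) (locally 0).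
Proof.
intros Hf.
assert (H0 : is_lim (fun x => C * / x) p_infty 0).
{ replace (Finite 0) with (Rbar_mult C (Finite 0)) by (simpl; f_equal; ring).
  apply (is_lim_scal_l (fun x => / x) C p_infty 0).
  apply (is_lim_inv (fun x => x) p_infty p_infty); [apply is_lim_id | easy]. }
apply (is_lim_le_le_loc (fun x => - (C * / x)) (fun x => C * / x) f p_infty 0).
- exists X; intros x Hx; specialize (Hf x Hx).
  apply Rabs_le_between in Hf; unfold Rdiv in Hf; lra.
- replace (Finite 0) with (Rbar_opp (Finite 0)) by (simpl; f_equal; ring).
  now apply is_lim_opp.
- exact H0.
Qed.

(** The vertical segment joining the real axis to the tail of the contour
    becomes negligible at infinity, since its height PI / 2 - 1 stays strictly
    below PI / 2, where cos w vanishes.  The bound 1 / x is crude but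
    sufficient. *)
Lemma vertical_decay s t y c :
  4 <= t -> 0 < y < 1 -> Rabs s <= 1 ->
  filterlim (fun x => RInt (fun w => integrand_im s t y c x w) 0 (PI / 2 - 1))
    (Rbar_locally p_infty) (locally 0).
Proof.
intros Ht Hy Hs.
assert (HPI := PI2_1).
set (k := y / 2 * sin 1).
assert (Hk : 0 < k).
{ assert (H := sin_1_lower); unfold k; apply Rmult_lt_0_compat; lra. }
apply (filterlim_inv_bound _ ((PI / 2 - 1) * (4 / k ^ 2)) 0).
intros x Hx.
assert (B : forall w, 0 <= w <= PI / 2 - 1 ->
  Rabs (integrand_im s t y c x w) <= 4 / k ^ 2 * / x).
{ intros w Hw; unfold integrand_im.
  set (phi := _ + c).
  apply Rabs_mult_bounded_le; [left; apply exp_pos | apply SIN_bound |].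
  apply Rle_trans with (exp (- (k * exp x) + x)).
  - apply exp_le.
    assert (Hc : sin 1 <= cos w).
    { rewrite <- cos_shift; apply cos_decr_1; lra. }
    assert (Hch : exp x / 2 <= cosh x).
    { unfold cosh; assert (H := exp_pos (- x)); lra. }
    assert (He := exp_pos x).
    assert (H1 := sin_1_lower).
    assert (k * exp x <= y * cosh x * cos w).
    { replace (k * exp x) with (y * (exp x / 2) * sin 1) by (unfold k; field).
      apply Rmult_le_compat; try lra; [apply Rmult_le_pos; lra|].
      apply Rmult_le_compat_l; lra. }
    assert (s * x <= x).
    { assert (Ha := Rle_abs s); nra. }
    nra.
  - set (z := exp x) in *.
    assert (Hz : x < z) by (assert (H := exp_ineq1_le x); unfold z; lra).
    rewrite exp_plus, exp_Ropp; fold z.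
    assert (Hq := exp_lower_quadratic (k * z) ltac:(apply Rmult_le_pos; lra)).
    assert (0 < k * z) by (apply Rmult_lt_0_compat; lra).
    apply Rle_trans with (/ ((k * z) * (k * z) / 4) * z).
    + apply Rmult_le_compat_r; [lra|]; apply Rinv_le_contravar; nra.
    + replace (/ (k * z * (k * z) / 4) * z) with (4 / k ^ 2 * / z) by (field; lra).
      apply Rmult_le_compat_l.
      * apply Rlt_le, Rdiv_lt_0_compat; [lra | now apply pow_lt].
      * apply Rinv_le_contravar; lra. }
replace ((PI / 2 - 1) * (4 / k ^ 2) / x)
  with ((PI / 2 - 1 - 0) * (4 / k ^ 2 * / x)) by (field; lra).
apply abs_RInt_le_const; [lra | | auto].
apply (ex_RInt_continuous (V := R_CompleteNormedModule)).
intros w _; apply (continuous_of_2d_r (integrand_im s t y c)), continuity_2d_integrand_im.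
Qed.

(** The contour runs from i (PI / 2 + u0) down with slope -1 through the saddle
    point u0 + i PI / 2, and then horizontally from abscissa u0 + 1.  Starting
    on the imaginary axis at that height, instead of at 0, leaves the integral
    over a vertical segment; that segment is common to the contours of the two
    half lines and cancels between them. *)
Lemma half_line_integral s t y c :
  4 <= t -> 0 < y < 1 -> Rabs s <= 1 ->
  exists L,
    filterlim (fun x => RInt (fun u => integrand_re s t y c u 0) 0 x)
      (Rbar_locally p_infty) (locally L) /\
    Rabs (L + RInt (fun w => integrand_im s t y c 0 w) 0 (PI / 2 + saddle t y))
    <= half_bound s t y.
Proof.
intros Ht Hy Hs.
assert (Hu := saddle_pos t y Ht Hy).
set (u0 := saddle t y) in *.
set (slant := fun x => PI / 2 + u0 - x).
set (flat := fun _ : R => PI / 2 - 1).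
set (W := path_integral s t y c flat).
set (h := lorentz_primitive s t y).
assert (I1 : forall x, 0 <= x <= u0 + 1 ->
  Rabs (path_integral s t y c slant x - path_integral s t y c slant 0) <= h x - h 0).
{ intros x Hx; apply (path_increment_le s t y c slant (-1)); try lra.
  - rewrite Rabs_left; lra.
  - intros z; unfold slant; auto_derive; [easy | ring].
  - intros z Hz; unfold slant.
    apply modulus_slant; auto; fold u0; lra. }
assert (I2 : forall a b, u0 + 1 <= a <= b -> Rabs (W b - W a) <= h b - h a).
{ intros a b Hab; apply (path_increment_le s t y c flat 0); try lra.
  - rewrite Rabs_R0; lra.
  - intros z; unfold flat; auto_derive; [easy | ring].
  - intros z Hz; apply modulus_tail; auto; fold u0; lra. }
assert (E0 : path_integral s t y c slant 0
  = - RInt (fun w => integrand_im s t y c 0 w) 0 (PI / 2 + u0)).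
{ unfold path_integral, slant; rewrite RInt_point, Rminus_0_r.
  unfold zero; simpl; ring. }
(* Both pieces of the contour have height PI / 2 - 1 at abscissa u0 + 1. *)
assert (E1 : path_integral s t y c slant (u0 + 1) = W (u0 + 1)).
{ unfold W, path_integral, slant, flat; do 2 f_equal; ring. }
destruct (filterlim_of_increment_le W h (u0 + 1) (half_bound s t y + h 0)) as [L HL].
{ exact I2. }
{ intros x; assert (H := lorentz_primitive_range s t y x 0 ltac:(lra)).
  unfold h; lra. }
exists L; split.
- assert (HV := vertical_decay s t y c Ht Hy Hs).
  assert (HWV := filterlim_comp_2 _ _ (@plus R_NormedModule) HL HV (filterlim_plus L 0)).
  unfold plus in HWV; simpl in HWV; rewrite Rplus_0_r in HWV.
  apply filterlim_ext with (2 := HWV); intros x; simpl.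
  unfold W, path_integral, flat; simpl; ring.
- assert (B : forall x, u0 + 1 <= x ->
    Rabs (W x + RInt (fun w => integrand_im s t y c 0 w) 0 (PI / 2 + u0)) <= half_bound s t y).
  { intros x Hx.
    assert (H1 := I1 (u0 + 1) ltac:(lra)); rewrite E0, E1 in H1.
    assert (H2 := I2 (u0 + 1) x ltac:(lra)).
    assert (H3 := lorentz_primitive_range s t y x 0 ltac:(lra)); fold h in H3.
    apply Rabs_le_between in H1; apply Rabs_le_between in H2.
    apply Rabs_le; lra. }
  set (V0 := RInt _ _ _) in *.
  change (is_lim W p_infty L) in HL.
  apply Rabs_le; split.
  + enough (- half_bound s t y - V0 <= L) by lra.
    change (Rbar_le (- half_bound s t y - V0) L).
    apply (is_lim_le_loc (fun _ => - half_bound s t y - V0) W p_infty _ L); auto.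
    * exists (u0 + 1); intros x Hx; specialize (B x ltac:(lra)).
      apply Rabs_le_between in B; lra.
    * apply is_lim_const.
  + enough (L <= half_bound s t y - V0) by lra.
    change (Rbar_le L (half_bound s t y - V0)).
    apply (is_lim_le_loc W (fun _ => half_bound s t y - V0) p_infty L _); auto.
    * exists (u0 + 1); intros x Hx; specialize (B x ltac:(lra)).
      apply Rabs_le_between in B; lra.
    * apply is_lim_const.
Qed.

(** * The integral over the whole line *)

(** The reflection z -> - conj z exchanges the two half lines, at the cost of
    changing the signs of s and of the phase. *)
Lemma integrand_re_reflect s t y c x w :
  integrand_re s t y c (- x) w = integrand_re (- s) t y (- c) x w.
Proof.
unfold integrand_re, cosh, sinh; rewrite Ropp_involutive; f_equal.
- f_equal; field.
- rewrite <- cos_neg; f_equal; field.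
Qed.

Lemma integrand_im_reflect s t y c x w :
  integrand_im s t y c (- x) w = - integrand_im (- s) t y (- c) x w.
Proof.
unfold integrand_im, cosh, sinh; rewrite Ropp_involutive.
rewrite (Ropp_mult_distr_r (exp _) (sin _)), <- sin_neg.
f_equal; f_equal; field.
Qed.

Lemma continuous_integrand_re s t y c w x : continuous (fun u => integrand_re s t y c u w) x.
Proof. apply (continuous_of_2d_l (integrand_re s t y c)), continuity_2d_integrand_re. Qed.

Lemma ex_RInt_integrand_re s t y c w a b : ex_RInt (fun u => integrand_re s t y c u w) a b.
Proof.
apply (ex_RInt_continuous (V := R_CompleteNormedModule)).
intros u _; apply continuous_integrand_re.
Qed.

Lemma RInt_integrand_re_reflect s t y c x :
  RInt (fun u => integrand_re s t y c u 0) 0 x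
  = - RInt (fun u => integrand_re (- s) t y (- c) u 0) 0 (- x).
Proof.
apply is_RInt_unique.
apply is_RInt_ext with (fun u => opp (opp (integrand_re (- s) t y (- c) (- u) 0))).
{ intros u _; rewrite opp_opp, integrand_re_reflect; now rewrite !Ropp_involutive. }
apply (is_RInt_opp (V := R_NormedModule)).
apply (is_RInt_comp_opp (V := R_NormedModule) (fun u => integrand_re (- s) t y (- c) u 0)).
rewrite Ropp_0; apply (RInt_correct (V := R_CompleteNormedModule)), ex_RInt_integrand_re.
Qed.

Lemma is_RInt_gen_of_filterlim (f : R -> R) (Fa Fb : (R -> Prop) -> Prop)
    {FFa : Filter Fa} {FFb : Filter Fb} (la lb : R) :
  (forall x, continuous f x) ->
  filterlim (fun x => RInt f 0 x) Fa (locally la) ->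
  filterlim (fun x => RInt f 0 x) Fb (locally lb) ->
  is_RInt_gen f Fa Fb (lb - la).
Proof.
intros cf Ha Hb.
assert (dI : forall x, is_derive (fun x => RInt f 0 x) x (f x)).
{ intros x; apply (is_derive_RInt f _ 0); [|easy].
  apply filter_forall; intros z.
  apply (RInt_correct (V := R_CompleteNormedModule)).
  apply (ex_RInt_continuous (V := R_CompleteNormedModule)); auto. }
assert (E : forall x, Derive (fun x => RInt f 0 x) x = f x).
{ intros x; apply is_derive_unique, dI. }
apply is_RInt_gen_ext with (Derive (fun x => RInt f 0 x)); auto.
{ apply filter_forall; auto. }
apply is_RInt_gen_Derive; auto; apply filter_forall; intros ab x _.
- eexists; apply dI.
- apply (continuous_ext f); auto.
Qed.

Lemma is_RInt_gen_C (f g : R -> R) (Fa Fb : (R -> Prop) -> Prop)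
    {FFa : Filter Fa} {FFb : Filter Fb} (lf lg : R) :
  is_RInt_gen f Fa Fb lf -> is_RInt_gen g Fa Fb lg ->
  is_RInt_gen (V := C_R_NormedModule) (fun u => (f u, g u)) Fa Fb (lf, lg).
Proof.
intros Hf Hg P [eps HP].
assert (Bf := Hf (ball lf eps) (locally_ball lf eps)).
assert (Bg := Hg (ball lg eps) (locally_ball lg eps)).
unfold filtermapi in *.
generalize (filter_and _ _ Bf Bg); apply filter_imp.
intros ab [[vf [If bf]] [vg [Ig bg]]].
exists (vf, vg); split.
- now apply (is_RInt_fct_extend_pair (U := R_NormedModule) (V := R_NormedModule)).
- now apply HP.
Qed.

(** Both half lines are instances of [half_line_integral].  Their vertical
    segments carry opposite values, because the imaginary part changes sign
    under the reflection, so only the two saddle contributions remain. *)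
Lemma line_integral s t y c :
  4 <= t -> 0 < y < 1 -> Rabs s <= 1 ->
  exists L : R,
    is_RInt_gen (fun u => integrand_re s t y c u 0)
      (Rbar_locally m_infty) (Rbar_locally p_infty) L /\
    Rabs L <= 2 * half_bound s t y.
Proof.
intros Ht Hy Hs.
destruct (half_line_integral s t y c Ht Hy Hs) as [Lp [HLp Bp]].
destruct (half_line_integral (- s) t y (- c) Ht Hy ltac:(now rewrite Rabs_Ropp))
  as [Lm [HLm Bm]].
assert (Eb : half_bound (- s) t y = half_bound s t y).
{ unfold half_bound, envelope; now rewrite Rabs_Ropp. }
rewrite Eb in Bm.
assert (EV : forall b, RInt (fun w => integrand_im (- s) t y (- c) 0 w) 0 b
  = - RInt (fun w => integrand_im s t y c 0 w) 0 b).
{ intros b.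
  rewrite <- (RInt_opp (V := R_CompleteNormedModule)).
  - apply RInt_ext; intros w _; rewrite <- Ropp_0 at 2; rewrite integrand_im_reflect.
    unfold opp; simpl; ring.
  - apply (ex_RInt_continuous (V := R_CompleteNormedModule)).
    intros w _; apply (continuous_of_2d_r (integrand_im s t y c)), continuity_2d_integrand_im. }
rewrite EV in Bm.
exists (Lp - - Lm); split.
- apply is_RInt_gen_of_filterlim; try typeclasses eauto; [| |easy].
  + intros x; apply continuous_integrand_re.
  + apply filterlim_ext with
      (fun x => - RInt (fun u => integrand_re (- s) t y (- c) u 0) 0 (- x)).
    { intros x; now rewrite <- RInt_integrand_re_reflect. }
    apply filterlim_comp with (2 := filterlim_opp (V := R_NormedModule) Lm).
    apply filterlim_comp with (2 := HLm).
    apply (filterlim_Rbar_opp m_infty).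
- apply Rabs_le_between in Bp; apply Rabs_le_between in Bm; apply Rabs_le; lra.
Qed.

(** * The bound for the Bessel function *)

(** The saddle point satisfies exp (s u0) = (2 t / y)^s with s = r - 1/2, which
    is where the powers of y and t come from; the width t^(-1/2) of the
    Lorentzian turns t^(r - 1/2) into t^(r - 1). *)
Lemma half_bound_le r t y :
  4 <= t -> 0 < y < 1 -> 1 / 2 <= r <= 3 / 2 ->
  half_bound (r - 1 / 2) t y
  <= 32 * PI * exp (3 / 2)
     * (Rpower y (1 / 2 - r) * exp (- (t * PI / 2)) * Rpower t (r - 1)).
Proof.
intros Ht Hy Hr; unfold half_bound, envelope, saddle.
rewrite (Rabs_pos_eq (r - 1 / 2)) by lra.
assert (E : exp ((r - 1 / 2) * ln (2 * t / y)) / sqrt t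
  = Rpower 2 (r - 1 / 2) * (Rpower y (1 / 2 - r) * Rpower t (r - 1))).
{ replace (r - 1) with ((r - 1 / 2) + (- / 2)) by field.
  rewrite Rpower_plus, Rpower_Ropp, Rpower_sqrt by lra.
  unfold Rdiv; rewrite ln_mult, ln_mult, ln_Rinv; try lra.
  2: apply Rinv_0_lt_compat; lra.
  unfold Rpower; rewrite <- !Rmult_assoc, <- !exp_plus; f_equal; f_equal; ring. }
assert (H2 : Rpower 2 (r - 1 / 2) <= 2).
{ apply Rle_trans with (Rpower 2 1); [apply Rle_Rpower | rewrite Rpower_1]; lra. }
set (p := exp (- (t * PI / 2))) in *.
replace (16 * PI * exp (3 / 2) * (p * exp ((r - 1 / 2) * ln (2 * t / y)) / sqrt t))
  with (16 * PI * exp (3 / 2) * p * (exp ((r - 1 / 2) * ln (2 * t / y)) / sqrt t))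
  by (unfold Rdiv; ring).
rewrite E.
set (q := Rpower y _ ); set (z := Rpower t _).
replace (32 * PI * exp (3 / 2) * (q * p * z))
  with (16 * PI * exp (3 / 2) * p * (2 * (q * z))) by ring.
assert (HPI := PI_RGT_0).
assert (0 < q) by apply exp_pos; assert (0 < z) by apply exp_pos.
apply Rmult_le_compat_l.
- apply Rmult_le_pos; [apply Rmult_le_pos|]; [lra | | ]; left; apply exp_pos.
- apply Rmult_le_compat_r; [apply Rmult_le_pos; lra | easy].
Qed.

(** Reduces the imaginary part, and negative t, to a cosine of |t| u with a
    constant phase. *)
Lemma oscillation_as_cos t :
  exists c, forall u, cos (t * u) = cos (Rabs t * u)
                   /\ sin (t * u) = cos (Rabs t * u + c).
Proof.
destruct (Rle_dec 0 t) as [H | H].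
- exists (- (PI / 2)); intros u; rewrite Rabs_pos_eq by easy.
  rewrite cos_plus, cos_neg, sin_neg, cos_PI2, sin_PI2; split; ring.
- exists (PI / 2); intros u; rewrite Rabs_left by lra.
  rewrite cos_plus, cos_PI2, sin_PI2, Ropp_mult_distr_l_reverse, cos_neg, sin_neg.
  split; ring.
Qed.

Theorem proposition1p8 :
  exists (T0 : R) (A : R -> R),
    1 <= T0 /\
    (forall t0 : R, T0 <= t0 ->
       forall r t y : R,
         1 / 2 <= r <= 3 / 2 -> t0 <= Rabs t -> 0 < y < 1 ->
         Cmod (BesselK (r - 1 / 2, t) y)
         <= A t0 * (Rpower y (1 / 2 - r) * exp (- (Rabs t * PI / 2))
                    * Rpower (Rabs t) (r - 1))) /\
    (exists T1 M : R, forall t0 : R, T1 <= t0 -> Rabs (A t0) <= M).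
Proof.
(* 64 is 32 times 1/2, from the definition of the Bessel function, times 2 >=
   sqrt 2, from the comparison of a complex number with its two parts, times 2
   for the two half lines. *)
exists 4, (fun _ => 64 * PI * exp (3 / 2)); split; [lra|split].
2: { exists 0, (Rabs (64 * PI * exp (3 / 2))); intros; apply Rle_refl. }
intros t0 Ht0 r t y Hr Ht Hy.
assert (Ht4 : 4 <= Rabs t) by lra.
assert (Hs : Rabs (r - 1 / 2) <= 1) by (apply Rabs_le; lra).
destruct (oscillation_as_cos t) as [c Hc].
destruct (line_integral _ _ _ 0 Ht4 Hy Hs) as [Lre [Ire Bre]].
destruct (line_integral _ _ _ c Ht4 Hy Hs) as [Lim [Iim Bim]].
assert (I := is_RInt_gen_C _ _ _ _ _ _ Ire Iim).
assert (EK : BesselK (r - 1 / 2, t) y = Cmult (RtoC (1 / 2)) (Lre, Lim)).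
{ unfold BesselK; f_equal.
  apply (@is_RInt_gen_unique C_R_CompleteNormedModule); try typeclasses eauto.
  refine (is_RInt_gen_ext _ _ _ _ I).
  apply filter_forall; intros ab u _.
  destruct (Hc u) as [Hcos Hsin].
  unfold integrand_re, Cexp, Cplus, Cmult, RtoC, Re, Im; simpl.
  rewrite cos_0, sin_0.
  replace (0 + ((r - 1 / 2) * 0 + t * u)) with (t * u) by ring.
  rewrite Hcos, Hsin; f_equal; f_equal; f_equal; ring. }
rewrite EK, Cmod_mult, Cmod_R, Rabs_pos_eq by lra.
assert (B := Cmod_2Rmax (Lre, Lim)); simpl in B.
assert (Hmax : Rmax (Rabs Lre) (Rabs Lim) <= 2 * half_bound (r - 1 / 2) (Rabs t) y)
  by (apply Rmax_lub; easy).
assert (Hmax0 := Rle_trans _ _ _ (Rabs_pos Lre) (Rmax_l (Rabs Lre) (Rabs Lim))).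
assert (Hq : 0 <= sqrt 2 <= 2).
{ split; [apply sqrt_pos|]; rewrite <- (sqrt_square 2) at 2 by lra.
  apply sqrt_le_1; lra. }
assert (Hh := half_bound_le r (Rabs t) y Ht4 Hy Hr).
nra.
Qed.
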